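(* Let $A\in\mathbb{R}^{n\times n}$ be symmetric positive definite and $B\in\mathbb{R}^{n\times n}$. Let $\tilde s$ be the projection of $s\in\mathbb{R}^n$ onto $\ker(B-A)^{\perp_A}$ (orthogonal with respect to $\langle\cdot,\cdot\rangle_A$), and assume $\tilde s\ne0$. Then $$\frac{\|A^{-1/2}(B-A)s\|_2^2}{\|A^{1/2}s\|_2^2}\le\frac{\|A^{-1/2}(B-A)\tilde s\|_2^2}{\|A^{1/2}\tilde s\|_2^2},$$ with equality if and only if $s\in\ker(B-A)^{\perp_A}$.
   Context: $\langle a,b\rangle_A=a^\top Ab$; for a subspace $V\subseteq\mathbb{R}^n$, $V^{\perp_A}=\{z:\langle z,x\rangle_A=0\ \forall x\in V\}$, and projection onto $V^{\perp_A}$ means the orthogonal projection with respect to $\langle\cdot,\cdot\rangle_A$. $A^{1/2}$ is the symmetric positive definite square root of $A$ and $A^{-1/2}$ its inverse. *)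

(* Defs.v *)
From mathcomp Require Import all_boot all_order all_algebra.
From mathcomp Require Import boolp classical_sets reals.
From mathcomp Require Import sesquilinear spectral.
From mathcomp Require Import complex.

Set Implicit Arguments.
Unset Strict Implicit.
Unset Printing Implicit Defensive.

Import Order.TTheory GRing.Theory Num.Theory.
Local Open Scope classical_set_scope.
Local Open Scope ring_scope.

Section Definitions.
Variables (R : realType) (n : nat).
Implicit Types (A H M : 'M[R]_n) (a b s t x : 'cV[R]_n) (V W : set 'cV[R]_n).

(* The norm `|x| that MathComp-Analysis puts on matrices is the sup norm. *)
Definition l2norm x : R := Num.sqrt (\sum_(i < n) x i 0 ^+ 2).

Definition mxdot A a b : R := (a^T *m A *m b) 0 0.

Definition spdmx A : Prop :=
  A^T = A /\ forall x, x != 0 -> 0 < mxdot A x x.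

Definition is_sqrtmx A H : Prop := spdmx H /\ H *m H = A.

(* Meaningful for symmetric positive definite A, for which such an H exists
   and is unique (spd_sqrtmxP and is_sqrtmx_uniq below). *)
Definition sqrtmx A : 'M[R]_n := xget 0 [set H | is_sqrtmx A H].

Definition kerset M : set 'cV[R]_n := [set x | M *m x = 0].

Definition orthoset A V : set 'cV[R]_n :=
  [set z | forall x, V x -> mxdot A z x = 0].

Definition is_orthoproj A W s t : Prop :=
  W t /\ forall w, W w -> mxdot A (s - t) w = 0.

End Definitions.

Section SquareRoot.
Variable R : realType.

Lemma spdmx_unit n (A : 'M[R]_n) : spdmx A -> A \in unitmx.
Proof.
move=> [Asym Apos]; rewrite -row_free_unit -kermx_eq0; apply/eqP/row_matrixP.
move=> i; rewrite row0; apply/eqP; rewrite -[_ == 0]negbK; apply/negP.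
have kA : row i (kermx A) *m A = 0 by rewrite -row_mul mulmx_ker row0.
rewrite -trmx_eq0 => /Apos; rewrite /mxdot trmxK kA mul0mx mxE ltxx //.
Qed.

Lemma mxdot_ge0 n (A : 'M[R]_n) x : spdmx A -> 0 <= mxdot A x x.
Proof.
move=> [_ Apos]; have [->|/Apos/ltW//] := eqVneq x 0.
by rewrite /mxdot mulmx0 mxE.
Qed.

Lemma is_sqrtmx_uniq n (A H K : 'M[R]_n) :
  is_sqrtmx A H -> is_sqrtmx A K -> H = K.
Proof.
move=> [spdH HH] [spdK KK]; apply/eqP; rewrite -subr_eq0; set X := H - K.
have [Ks Kp] := spdK.
have eX : H *m X + X *m K = 0.
  by rewrite /X mulmxBr mulmxBl HH KK subrKA subrr.
have Xs : X^T = X by rewrite /X linearB /= spdH.1 spdK.1.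
have trq (Q : 'M[R]_n) :
    \tr (X *m Q *m X) = \sum_i mxdot Q (col i X) (col i X).
  apply: eq_bigr => i _; rewrite /mxdot tr_col Xs rowE colE.
  by rewrite !mulmxA -(mulmxA _ X Q) -(mulmxA _ (X *m Q)) -colE -rowE !mxE.
have : \tr (X *m H *m X) + \tr (X *m K *m X) = 0.
  by rewrite (mxtrace_mulC (X *m K) X) -mulmxA -mxtraceD -mulmxDr eX mulmx0 mxtrace0.
rewrite !trq => /eqP; rewrite paddr_eq0 ?sumr_ge0 // => [/andP[+ _]|i _|i _];
  [|exact: mxdot_ge0|exact: mxdot_ge0].
rewrite psumr_eq0 => [/allP H0|i _]; last exact: mxdot_ge0.
apply/eqP/trmx_inj/row_matrixP => i; rewrite trmx0 row0 -tr_col.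
apply/eqP; rewrite trmx_eq0; apply/negPn/negP => /spdH.2.
by rewrite (eqP (H0 i _)) ?mem_index_enum ?ltxx.
Qed.

Lemma poly_interp (F : fieldType) (s : seq F) (f : F -> F) :
  exists p : {poly F}, {in s, forall x, p.[x] = f x}.
Proof.
elim: s => [|a s [p IH]]; first by exists 0.
have [sa|sa] := boolP (a \in s).
  by exists p => x; rewrite inE => /predU1P[->|]; apply: IH.
pose q : {poly F} := \prod_(y <- s) ('X - y%:P).
have qa : q.[a] != 0 by rewrite -[_ == 0]/(root q a) root_prod_XsubC.
exists (p + ((f a - p.[a]) / q.[a]) *: q) => x; rewrite inE hornerD hornerZ.
case/predU1P=> [->|sx]; first by rewrite divfK // addrC subrK.
have /eqP-> : root q x by rewrite root_prod_XsubC.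
by rewrite mulr0 addr0 IH.
Qed.

Lemma spdmx_diag (C : numClosedFieldType) (toC : {rmorphism R -> C}) n
    (A : 'M[R]_n) :
  (forall z, z \is Num.real <-> exists k, z = toC k) -> spdmx A ->
  exists (P : 'M[C]_n) (d : 'rV[R]_n),
    [/\ P \in unitmx, (forall i, 0 < d 0 i) &
      map_mx toC A = invmx P *m diag_mx (map_mx toC d) *m P].
Proof.
move=> realP [Asym Apos].
have Areal : map_mx toC A \is a realmx.
  by apply/mxOverP => i j; rewrite mxE; apply/realP; exists (A i j).
have Aherm : map_mx toC A \is hermsymmx.
  apply: realsym_hermsym => //; apply/is_hermitianmxP.
  by rewrite expr0 scale1r map_mx_id // map_trmx Asym.
have /orthomx_spectralP eA := hermitian_normalmx Aherm.
have Dreal := hermitian_spectral_diag_real Aherm.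
have := spectral_unit (map_mx toC A).
move: (spectralmx _) (spectral_diag _) eA Dreal => P D eA /mxOverP Dreal uP.
have [d Dd] : exists d, D = map_mx toC d.
  have /choice[f Df] i : exists k, D 0 i = toC k by apply/realP.
  by exists (\row_i f i); apply/rowP => i; rewrite !mxE.
exists P, d; split=> //; last by rewrite -Dd.
move=> i; have : eigenvalue (map_mx toC A) (toC (d 0 i)).
  apply/eigenvalueP; exists (row i P).
    by rewrite eA -row_mul !mulmxA mulmxV // mul1mx Dd row_mul row_diag_mx
      -scalemxAl -rowE mxE.
  apply/eqP => Pi0; have := mulmxV uP => /(congr1 (row i)).
  rewrite row_mul Pi0 mul0mx => /rowP/(_ i); rewrite !mxE eqxx => /eqP.
  by rewrite eq_sym oner_eq0.
rewrite eigenvalue_map => /eigenvalueP[v vA v0].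
have /Apos : v^T != 0 by rewrite trmx_eq0.
rewrite /mxdot trmxK vA -scalemxAl mxE => dv; rewrite ltNge; apply/negP => d0.
move: dv; rewrite ltNge => /negP; apply; rewrite mulr_le0_ge0 // mxE.
by apply: sumr_ge0 => j _; rewrite mxE -expr2 sqr_ge0.
Qed.

Lemma spd_sqrtmxP n (A : 'M[R]_n) : spdmx A -> is_sqrtmx A (sqrtmx A).
Proof.
move=> spdA; apply: (xgetPex 0 (P := [set H | is_sqrtmx A H])).
case: n => [|n] in A spdA *.
  exists 0; split; last by apply/matrixP => -[].
  split=> [|x]; first by apply/matrixP => -[].
  by case/eqP; apply/matrixP => -[].
have [C [toC realP]] : exists (C : numClosedFieldType) (toC : {rmorphism R -> C}),
    forall z, z \is Num.real <-> exists k, z = toC k.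
  by exists (complex R), (real_complex R); split=> /complex_realP.
have [P [d [uP d_gt0 eA]]] := spdmx_diag realP spdA.
have [p pd] := poly_interp [seq d 0 i | i : 'I_n.+1] (fun x => Num.sqrt (Num.sqrt x)).
pose G := horner_mx A p.
have Gs : G^T = G.
  rewrite /G; elim/poly_ind: p {pd G} => [|q c IH]; first by rewrite rmorph0 trmx0.
  rewrite rmorphD rmorphM /= horner_mx_X horner_mx_C linearD /= tr_scalar_mx.
  congr (_ + _); rewrite -[X in X^T]/(_ *m _) trmx_mul IH spdA.1.
  exact: (comm_mx_horner q (erefl _ : comm_mx A A)).
have G4 : (G *m G) *m (G *m G) = A.
  apply: (map_mx_inj (f := toC)).
  have pd4 i : p.[d 0 i] ^+ 4 = d 0 i.
    rewrite pd ?(exprM _ 2 2) ?sqr_sqrtr ?sqrtr_ge0 ?ltW //.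
    by apply/mapP; exists i; rewrite ?mem_enum.
  rewrite -[LHS]/(map_mx toC (horner_mx A p * horner_mx A p *
    (horner_mx A p * horner_mx A p))) -!rmorphM /= map_horner_mx eA.
  rewrite horner_mx_uconjC // horner_mx_diag; congr (_ *m diag_mx _ *m _).
  apply/rowP => i; rewrite !mxE horner_map /= -[in RHS](pd4 i) !hornerM.
  by rewrite -!expr2 -exprM.
exists (G *m G); split=> //; split; first by rewrite trmx_mul Gs.
move=> x x0; rewrite /mxdot -{1}Gs !mulmxA -trmx_mul -mulmxA.
have uG : G \in unitmx.
  by have := spdmx_unit spdA; rewrite -G4 !unitmx_mul => /andP[/andP[]].
have Gx0 : G *m x != 0.
  by apply: contra x0 => /eqP Gx; rewrite -(mulKmx uG x) Gx mulmx0.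
rewrite lt0r; apply/andP; split; last first.
  by rewrite mxE sumr_ge0 // => j _; rewrite mxE -expr2 sqr_ge0.
apply: contra Gx0; rewrite mxE psumr_eq0 => [/allP H|j _]; last first.
  by rewrite mxE -expr2 sqr_ge0.
apply/eqP/colP => j; rewrite [RHS]mxE; apply/eqP.
by have := H j (mem_index_enum _); rewrite /= mxE -expr2 sqrf_eq0.
Qed.

End SquareRoot.

(* Main.v *)
(* The residual s - st is A-orthogonal to the A-orthogonal complement of
   ker (B - A), hence lies in ker (B - A): both quotients have the same
   numerator, which is nonzero because st <> 0 is orthogonal to the kernel,
   while by Pythagoras the denominator for s exceeds the one for st by the
   squared A-norm of s - st. *)

Require Import Defs.
From mathcomp Require Import all_boot all_order all_algebra.
From mathcomp Require Import boolp classical_sets reals.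

Set Implicit Arguments.
Unset Strict Implicit.
Unset Printing Implicit Defensive.

Import Order.TTheory GRing.Theory Num.Theory.
Local Open Scope classical_set_scope.
Local Open Scope ring_scope.

Section L2norm.
Variables (R : realType) (n : nat).
Implicit Types (A : 'M[R]_n) (x : 'cV[R]_n).

Lemma l2norm_sqr x : l2norm x ^+ 2 = (x^T *m x) 0 0.
Proof.
rewrite sqr_sqrtr ?sumr_ge0 // => [|i _]; last exact: sqr_ge0.
by rewrite mxE; apply: eq_bigr => i _; rewrite mxE expr2.
Qed.

Lemma l2norm_sqr_gt0 x : x != 0 -> 0 < l2norm x ^+ 2.
Proof.
move=> x0; rewrite lt0r sqr_ge0 andbT; apply: contra x0.
rewrite sqr_sqrtr ?sumr_ge0 // => [|i _]; last exact: sqr_ge0.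
rewrite psumr_eq0 => [/allP H|i _]; last exact: sqr_ge0.
apply/eqP/colP => i; rewrite mxE; apply/eqP.
by have := H i (mem_index_enum _); rewrite /= sqrf_eq0.
Qed.

(** This rewrites the denominators of the two quotients as values of [mxdot A], where orthogonality
    can be used. *)
Lemma l2norm_sqrtmx A x : spdmx A -> l2norm (sqrtmx A *m x) ^+ 2 = mxdot A x x.
Proof.
move=> /spd_sqrtmxP[[Hs _] HH].
by rewrite l2norm_sqr /mxdot -[in RHS]HH trmx_mul Hs !mulmxA.
Qed.

End L2norm.

Section Orthogonal.
Variables (R : realType) (n : nat).
Implicit Types (A M : 'M[R]_n) (a b r s t x : 'cV[R]_n)
  (V W : set 'cV[R]_n).

Lemma mxdotC A a b : A^T = A -> mxdot A a b = mxdot A b a.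
Proof.
by move=> sA; rewrite /mxdot -[in LHS](trmxK b) -{1}sA -mulmxA -!trmx_mul mxE.
Qed.

Lemma mxdotDl A a b x : mxdot A (a + b) x = mxdot A a x + mxdot A b x.
Proof. by rewrite /mxdot linearD /= !mulmxDl mxE. Qed.

Lemma mxdotDr A a b x : mxdot A x (a + b) = mxdot A x a + mxdot A x b.
Proof. by rewrite /mxdot mulmxDr mxE. Qed.

Lemma mxdot_eq0 A x : spdmx A -> mxdot A x x = 0 -> x = 0.
Proof.
by move=> [_ pA] x0; apply/eqP/negPn/negP => /pA; rewrite x0 ltxx.
Qed.

(* The vectors A^-1 M^T y lie in orthoset A (kerset M), and testing r against
   all of them gives M r = 0. *)
Lemma orthoset_ortho_kerset A M r : spdmx A ->
  (forall w, orthoset A (kerset M) w -> mxdot A r w = 0) -> kerset M r.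
Proof.
move=> spdA rW; have uA := spdmx_unit spdA; have [sA _] := spdA.
rewrite /kerset /=; apply: trmx_inj; rewrite trmx0 trmx_mul.
apply/rowP => j; rewrite [RHS]mxE.
have <- : mxdot A r (invmx A *m M^T *m delta_mx j 0) = (r^T *m M^T) 0 j.
  by rewrite /mxdot !mulmxA mulmxK // -colE mxE.
(* For [x] in the kernel, [A] cancels [invmx A], and what remains contains the factor
   [M *m x = 0]. *)
apply: rW => x Mx; rewrite /mxdot !trmx_mul trmxK trmx_inv sA.
by rewrite -!mulmxA mulKmx // Mx mulmx0 mxE.
Qed.

Lemma orthoproj_sub_kerset A M s t : spdmx A ->
  is_orthoproj A (orthoset A (kerset M)) s t -> kerset M (s - t).
Proof. by move=> spdA [_ st]; apply: orthoset_ortho_kerset st. Qed.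

(** Pythagoras: [t] itself lies in [W], so both cross terms with [s - t] vanish. *)
Lemma mxdot_orthoproj A W s t : A^T = A -> is_orthoproj A W s t ->
  mxdot A s s = mxdot A t t + mxdot A (s - t) (s - t).
Proof.
move=> sA [Wt st]; have st0 := st _ Wt.
rewrite -{1 2}(subrK t s); move: (s - t) st0 => r st0.
rewrite mxdotDl !mxdotDr st0 mxdotC // st0.
by rewrite addr0 add0r addrC.
Qed.

(** When [s] lies in the orthogonal set, so does [s - t], which is then A-orthogonal to itself and
    hence zero. *)
Lemma orthoproj_orthoset A V s t : spdmx A ->
  is_orthoproj A (orthoset A V) s t -> s = t <-> orthoset A V s.
Proof.
move=> spdA [Wt st]; split=> [->//|Ws].
apply/eqP; rewrite -subr_eq0; apply/eqP/(mxdot_eq0 spdA)/st => x Vx.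
by rewrite mxdotDl (Ws _ Vx) -scaleN1r /mxdot linearZ /= -!scalemxAl mxE
  [X in _ * X](Wt _ Vx) mulr0 addr0.
Qed.

End Orthogonal.

Theorem corollary3p17 (R : realType) (n : nat) (A B : 'M[R]_n)
    (s st : 'cV[R]_n) (spdA : spdmx A)
    (st_proj : is_orthoproj A (orthoset A (kerset (B - A))) s st)
    (st_neq0 : st != 0) :
  let ratio (x : 'cV[R]_n) : R :=
    l2norm (invmx (sqrtmx A) *m (B - A) *m x) ^+ 2
    / l2norm (sqrtmx A *m x) ^+ 2 in
  ratio s <= ratio st /\
  (ratio s = ratio st <-> s \in orthoset A (kerset (B - A))).
Proof.
move=> ratio; have [sA pA] := spdA; have [Wt _] := st_proj.
have kr := orthoproj_sub_kerset spdA st_proj.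
have eM : (B - A) *m s = (B - A) *m st.
  by apply/eqP; rewrite -subr_eq0 -mulmxBr; apply/eqP.
(* A kernel vector that is also A-orthogonal to the kernel is A-orthogonal to itself. *)
have Mt0 : (B - A) *m st != 0.
  by apply: contra st_neq0 => /eqP Mt; apply/eqP/(mxdot_eq0 spdA)/Wt.
have uH := spdmx_unit (spd_sqrtmxP spdA).1.
have N_gt0 : 0 < l2norm (invmx (sqrtmx A) *m (B - A) *m st) ^+ 2.
  rewrite -mulmxA l2norm_sqr_gt0 //; apply: contra Mt0 => /eqP H0.
  by rewrite -(mulKVmx uH (_ *m st)) H0 mulmx0.
have eD := mxdot_orthoproj sA st_proj.
have r_ge0 := mxdot_ge0 (s - st) spdA.
have Dt_gt0 : 0 < mxdot A st st by apply: pA.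
(* Hence the quotient for [s] is no division by zero. *)
have Ds_gt0 : 0 < mxdot A s s by rewrite eD ltr_wpDr.
have -> : ratio s = l2norm (invmx (sqrtmx A) *m (B - A) *m st) ^+ 2 / mxdot A s s.
  by rewrite /ratio l2norm_sqrtmx // -!mulmxA eM.
rewrite /ratio l2norm_sqrtmx //; split.
  by rewrite ler_pM2l // lef_pV2 // eD lerDl.
rewrite in_setE -(orthoproj_orthoset spdA st_proj); split=> [|->//].
(* Cancelling the common nonzero numerator leaves equal denominators, so by Pythagoras the squared
   A-norm of [s - st] is zero. *)
move/(mulfI (lt0r_neq0 N_gt0))/invr_inj; rewrite eD => /eqP.
rewrite addrC -subr_eq0 addrK => /eqP/(mxdot_eq0 spdA)/eqP.
by rewrite subr_eq0 => /eqP.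
Qed.
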